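(* There is no regular graph of odd degree $d\ge3$, diameter $D\equiv 0\pmod 6$, and cyclic defect.
   Context: For an integer $d\ge 1$ define polynomials $G_{d,m}(x)$ by $G_{d,0}(x)=1$, $G_{d,1}(x)=x+1$, and $G_{d,m+1}(x)=xG_{d,m}(x)-(d-1)G_{d,m-1}(x)$ for $m\ge1$. Let $J_n$ be the $n\times n$ all-ones matrix. For a graph on $n\ge3$ vertices, a cycle matrix is the adjacency matrix $B$ of an $n$-cycle on the same vertex set (i.e., for some ordering $v_1,\dots,v_n$ of the vertices, $B_{ij}=1$ iff $v_i,v_j$ are cyclically consecutive, and $0$ otherwise); this cycle need not consist of edges of the graph. A graph $\Gamma$ of order $n$ with adjacency matrix $A$ is a graph of degree $d$, diameter $D$ and cyclic defect if $\Gamma$ is $d$-regular with $d\ge3$, has diameter $D\ge2$, and $G_{d,D}(A)=J_n+B$ for some cycle matrix $B$. *)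

(* Defs.v *)
From HB Require Import structures.
From mathcomp Require Import all_boot all_order all_algebra all_fingroup.

Set Implicit Arguments.
Unset Strict Implicit.
Unset Printing Implicit Defensive.

Import GRing.Theory.
Local Open Scope ring_scope.

Fixpoint G_poly (d m : nat) {struct m} : {poly int} :=
  match m with
  | 0 => 1
  | m'.+1 =>
    match m' with
    | 0 => 'X + 1
    | m''.+1 => 'X * G_poly d m' - (d%:R - 1)%:P * G_poly d m''
    end
  end.

(* Graphs have vertex set 'I_n.+1, hence order n.+1: polynomials are evaluated
   with horner_mx, which requires the matrix size to be a successor. *)

Definition simple_graph (n : nat) (e : rel 'I_n.+1) : Prop :=
  symmetric e /\ irreflexive e.

Definition regular_graph (n : nat) (e : rel 'I_n.+1) (d : nat) : Prop :=
  forall x, #|[set y | e x y]| = d.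

Definition walk_of_length (n : nat) (e : rel 'I_n.+1) (x y : 'I_n.+1)
    (k : nat) : Prop :=
  exists p : seq 'I_n.+1, [/\ path e x p, last x p = y & size p = k].

Definition at_distance (n : nat) (e : rel 'I_n.+1) (x y : 'I_n.+1)
    (k : nat) : Prop :=
  walk_of_length e x y k /\
  forall l : nat, walk_of_length e x y l -> (k <= l)%N.

(* A disconnected graph has no diameter. *)
Definition has_diameter (n : nat) (e : rel 'I_n.+1) (D : nat) : Prop :=
  (forall x y, exists2 k : nat, at_distance e x y k & (k <= D)%N) /\
  (exists x y, at_distance e x y D).

Definition adj_mx (n : nat) (e : rel 'I_n.+1) : 'M[int]_n.+1 :=
  \matrix_(x, y) (e x y)%:R.

(* v is the ordering v 0, ..., v n of the vertices along the cycle; ordS is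
   the successor modulo the number of vertices. *)
Definition cycle_mx (n : nat) (B : 'M[int]_n.+1) : Prop :=
  (3 <= n.+1)%N /\
  exists v : 'S_n.+1, forall i j : 'I_n.+1,
    B (v i) (v j) = ((j == ordS i) || (i == ordS j))%:R.

Definition cyclic_defect_graph (n : nat) (e : rel 'I_n.+1) (d D : nat) : Prop :=
  [/\ simple_graph e,
      regular_graph e d /\ (3 <= d)%N,
      has_diameter e D /\ (2 <= D)%N
    & exists2 B : 'M[int]_n.+1,
        cycle_mx B & horner_mx (adj_mx e) (G_poly d D) = const_mx 1 + B].

(* Main.v *)
(* Order the vertices along the n-cycle. Since A is regular and symmetric, it
   commutes with J, hence with B = G_{d,D}(A) - J; so a(i,j) := A(v_i,v_j) solves
   the discrete wave equation a(i,j-1) + a(i,j+1) = a(i-1,j) + a(i+1,j) on the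
   torus (Z/n)^2. A 0/1-valued solution is, on each parity class of i + j,
   a function of i - j alone or of i + j alone, so edges come in families of
   translations i ~ i + s or reflections i ~ c - i. Such families always close
   up to a non-backtracking walk of length 4 or 6. On the other hand
   G_{d,D}(A) counts non-backtracking walks of length at most D and has diagonal
   entries 1, so no such closed walk of length at most D exists: D < 6. *)
Require Import Defs.
From HB Require Import structures.
From mathcomp Require Import all_boot all_order all_algebra all_fingroup.
From mathcomp Require Import zify ring.

Import GRing.Theory Num.Theory.
Local Open Scope ring_scope.

(** * Non-backtracking walks and the matrices [G_poly d m] at [A] *)

Section NonBacktrackingWalks.

Variables (n d : nat) (e : rel 'I_n.+1).

(* Number of non-backtracking walks from x of length m.+1 (not m) whose last
   arc is (y, z). *)
Fixpoint nb_walks (m : nat) (x y z : 'I_n.+1) : nat :=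
  match m with
  | 0 => (x == y) && e y z
  | m'.+1 => (e y z * \sum_(t | t != z) nb_walks m' x t y)%N
  end.

Definition nb_walks_to m x z := (\sum_y nb_walks m x y z)%N.

Lemma nb_walks0_gt0 x y : e x y -> (0 < nb_walks 0 x x y)%N.
Proof. by move=> /= ->; rewrite eqxx. Qed.

Lemma nb_walksS_gt0 m x t y z :
  (0 < nb_walks m x t y)%N -> e y z -> t != z ->
  (0 < nb_walks m.+1 x y z)%N.
Proof. by move=> w_gt0 /= -> tz; rewrite mul1n (bigD1 t) //= addn_gt0 w_gt0. Qed.

Lemma nb_walks_edge m x y z : ~~ e y z -> nb_walks m x y z = 0%N.
Proof. by case: m => [|m] /= /negbTE->; rewrite ?andbF. Qed.

Hypotheses (e_sym : symmetric e) (e_reg : regular_graph e d).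

Lemma sum_edges y : (\sum_z e y z = d)%N.
Proof. by rewrite -(e_reg y) -sum1dep_card [RHS]big_mkcond. Qed.

Lemma sum_edges_but y t : e y t -> (\sum_(z | z != t) e y z = d.-1)%N.
Proof.
by move=> eyt; rewrite -(sum_edges y) [in RHS](bigD1 t) //= eyt.
Qed.

Lemma nb_walks_to0 x z : nb_walks_to 0 x z = e x z.
Proof.
rewrite /nb_walks_to (bigD1 x) //= eqxx /= big1 ?addn0 // => y.
by rewrite eq_sym => /negbTE->.
Qed.

(** A walk arriving at [z] has [d.-1] continuations that avoid its last edge. *)
Lemma sum_nb_walksS m x z :
  (\sum_y nb_walks m.+1 x z y = d.-1 * nb_walks_to m x z)%N.
Proof.
rewrite /= (eq_bigr (fun y => \sum_(t | t != y) e z y * nb_walks m x t z)%N);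
  last by move=> y _; rewrite big_distrr.
rewrite (exchange_big_dep xpredT) //= big_distrr /=; apply: eq_bigr => t _.
rewrite -big_distrl /=; have [ezt|/nb_walks_edge->] := boolP (e t z).
  by rewrite -(@sum_edges_but z t) 1?e_sym //; congr (_ * _)%N;
     apply: eq_bigl => y; rewrite eq_sym.
by rewrite !muln0.
Qed.

(** An edge appended to a walk either keeps it non-backtracking or reverses its last arc
    [(z, y)]. *)
Lemma nb_walks_toS m x z :
  (nb_walks_to m.+1 x z + \sum_y nb_walks m x z y =
   \sum_y nb_walks_to m x y * e y z)%N.
Proof.
rewrite /nb_walks_to -big_split; apply: eq_bigr => y _ /=.
rewrite [X in _ = (X * _)%N](bigD1 z) //= mulnDl addnC mulnC.
rewrite [in X in (_ + X)%N]mulnC; congr (_ + _)%N; last by rewrite mulnC.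
have [eyz|neyz] := boolP (e y z); first by rewrite muln1.
by rewrite muln0 nb_walks_edge // e_sym.
Qed.

Let A := adj_mx e.

(** Both sides obey the same three-term recurrence: multiplying by [A] appends an edge, and the
    walks that turn back are subtracted. *)
Lemma horner_G_polyB m :
  (0 < d)%N ->
  horner_mx A (G_poly d m.+1 - G_poly d m) =
  \matrix_(x, z) (nb_walks_to m x z)%:R.
Proof.
move=> d_gt0.
have mulA k : (\matrix_(x, z) (nb_walks_to k x z)%:R : 'M[int]_n.+1) *m A =
    \matrix_(x, z) (nb_walks_to k.+1 x z + \sum_y nb_walks k x z y)%:R.
  apply/matrixP => x z; rewrite !mxE nb_walks_toS natr_sum.
  by apply: eq_bigr => y _; rewrite !mxE natrM.
elim/ltn_ind: m => -[|[|m]] IH.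
- have -> : G_poly d 1 - G_poly d 0 = 'X by rewrite /= addrK.
  by rewrite horner_mx_X; apply/matrixP => x z; rewrite !mxE nb_walks_to0.
(* The constant is [d] and not [d - 1]: each of the [d] edges at the start can be traversed and then
   reversed. *)
- have -> : G_poly d 2 - G_poly d 1 =
      (G_poly d 1 - G_poly d 0) * 'X - (d%:R)%:P.
    by rewrite /= rmorphB /=; ring.
  rewrite rmorphB rmorphM /= horner_mx_X horner_mx_C (IH 0%N) //= -mulmxE mulA.
  apply/matrixP => x z; rewrite !mxE natrD.
  have -> : (\sum_y nb_walks 0 x z y = (x == z) * d)%N.
    by rewrite /= -(sum_edges z) big_distrr /=; apply: eq_bigr => y _;
       case: (x == z); rewrite ?mul1n.
  by rewrite mulnC natrM mulr_natr addrK.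
have -> : G_poly d m.+3 - G_poly d m.+2 =
   (G_poly d m.+2 - G_poly d m.+1) * 'X
   - (d%:R - 1)%:P * (G_poly d m.+1 - G_poly d m).
  have GS k : G_poly d k.+2 =
      'X * G_poly d k.+1 - (d%:R - 1)%:P * G_poly d k by [].
  rewrite (GS m.+1) [X in _ - X = _]GS.
  move: (G_poly d m.+2) (G_poly d m.+1) (G_poly d m) => g2 g1 g0; ring.
move: (IH m.+1 (ltnSn _)) (IH m (leqW (ltnSn _))).
move: (G_poly d m.+2 - G_poly d m.+1) (G_poly d m.+1 - G_poly d m) => p2 p1.
move=> h2 h1; rewrite rmorphB !rmorphM /= horner_mx_X horner_mx_C h2 h1.
rewrite -!mulmxE mulA mul_scalar_mx.
apply/matrixP => x z; rewrite !mxE sum_nb_walksS natrD natrM.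
by rewrite -subn1 natrB // addrK.
Qed.

(** The differences of consecutive [G_poly] telescope; the term [x == z] is the empty walk. *)
Lemma horner_G_poly_entry D x z :
  (0 < d)%N ->
  horner_mx A (G_poly d D) x z =
  ((x == z) + \sum_(m < D) nb_walks_to m x z)%:R.
Proof.
move=> d_gt0; elim: D => [|D IH].
  by rewrite big_ord0 addn0 /= rmorph1 mxE.
rewrite big_ord_recr /= addnA natrD -IH.
have -> : horner_mx A (G_poly d D.+1) =
    horner_mx A (G_poly d D) + horner_mx A (G_poly d D.+1 - G_poly d D).
  by rewrite -rmorphD addrC subrK.
by rewrite [in LHS]mxE horner_G_polyB // mxE.
Qed.

End NonBacktrackingWalks.

(** * Coordinates along the cycle *)

Section CycleCoordinates.

Variables (n : nat).
Local Notation Zn := 'I_n.+3.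

Lemma sum_cycle_row (F : Zn -> int) (j : Zn) :
  \sum_k F k * ((j == ordS k) || (k == ordS j))%:R = F (j - 1) + F (j + 1).
Proof.
have S1 (i : Zn) : ordS i = i + 1 by apply/esym/(@add_Zp_1 n.+3).
(* The order is at least 3, so 2 is nonzero and [j] has two distinct cycle neighbours. *)
have neq : j + 1 != j - 1.
  rewrite -subr_eq0 opprB addrC addrA subrK; apply/eqP => /(congr1 val).
  by rewrite /= modn_small.
rewrite (bigD1 (j - 1)) //= (bigD1 (j + 1)) //= !S1 subrK !eqxx orbT !mulr1.
rewrite addrA big1 ?addr0 // => k /andP[k1 k2].
rewrite (negbTE k2) orbF; case: eqP => [jk|_]; last by rewrite mulr0.
by rewrite jk S1 addrK eqxx in k1.
Qed.

Variables (A B : 'M[int]_n.+3) (v : 'S_n.+3).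
Hypothesis cycB :
  forall i j, B (v i) (v j) = ((j == ordS i) || (i == ordS j))%:R.

Lemma mulmx_cycler i j :
  (A *m B) (v i) (v j) = A (v i) (v (j - 1)) + A (v i) (v (j + 1)).
Proof.
rewrite mxE (reindex_inj (@perm_inj _ v)) /=.
rewrite -(sum_cycle_row (fun k => A (v i) (v k))).
by apply: eq_bigr => k _; rewrite cycB.
Qed.

Lemma mulmx_cyclel i j :
  (B *m A) (v i) (v j) = A (v (i - 1)) (v j) + A (v (i + 1)) (v j).
Proof.
rewrite mxE (reindex_inj (@perm_inj _ v)) /=.
rewrite -(sum_cycle_row (fun k => A (v k) (v j))).
by apply: eq_bigr => k _; rewrite cycB orbC mulrC.
Qed.

End CycleCoordinates.

(** * The discrete wave equation *)

Section WaveEquation.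

Variables (R : nzRingType) (a : R -> R -> int).
Hypothesis wave :
  forall i j, a i (j - 1) + a i (j + 1) = a (i - 1) j + a (i + 1) j.

(** The wave equation centred at [(i + 1, j)] equates the increments along two opposite sides of a
    small tilted square; iterate along the diagonal. *)
Lemma wave_diag (i j : R) (m : nat) :
  a (i + m%:R + 1) (j + m%:R - 1) - a (i + m%:R) (j + m%:R) =
  a (i + 1) (j - 1) - a i j.
Proof.
elim: m => [|m <-]; first by rewrite !addr0.
have transp (x y z w : int) : x + y = z + w -> w - y = x - z by lia.
rewrite -natr1 !addrA addrK; apply: transp.
by have := wave (i + m%:R + 1) (j + m%:R); rewrite addrK.
Qed.

(** Summing [wave_diag] over [l] steps gives a discrete form of d'Alembert's splitting into a
    function of [i + j] plus one of [i - j]. *)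
Lemma wave_rectangle (i j : R) (m l : nat) :
  a (i + m%:R + l%:R) (j + m%:R - l%:R) - a (i + m%:R) (j + m%:R) =
  a (i + l%:R) (j - l%:R) - a i j.
Proof.
elim: l => [|l IH]; first by rewrite !addr0 !subr0 !subrr.
have chain (p q r s x y : int) : p - q = r - s -> x - p = y - r -> x - q = y - s.
  by lia.
rewrite -natr1 opprD !addrA; apply: chain IH _.
have := wave_diag (i + l%:R) (j - l%:R) m.
by rewrite ![_ + l%:R + m%:R]addrAC ![_ - l%:R + m%:R]addrAC.
Qed.

End WaveEquation.

(** * Short closed walks forced by the rectangle rule *)

Definition closed_quad {T : eqType} (a : rel T) : Prop :=
  exists x y z t, [/\ a x y, a y z, a z t & a t x] /\ [/\ x != z & y != t].

(** The walk may turn back at its base point [x0], in line with [nb_walks], which constrains inner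
    vertices only. *)
Definition closed_hexa {T : eqType} (a : rel T) : Prop :=
  exists x0 x1 x2 x3 x4 x5,
    [/\ [/\ a x0 x1, a x1 x2 & a x2 x3], [/\ a x3 x4, a x4 x5 & a x5 x0],
        [/\ x0 != x2, x1 != x3 & x2 != x4] & [/\ x3 != x5 & x4 != x0]].

Section ShortCycles.

Variables (R : finComNzRingType) (a : rel R).
Hypotheses (a_sym : symmetric a) (a_irr : irreflexive a).
Hypothesis rect : forall i j m l,
  (a (i + m + l)%R (j + m - l)%R + a i j =
   a (i + m)%R (j + m)%R + a (i + l)%R (j - l)%R)%N.

(* A chord i ~ i + s invariant under translation closes up any other edge
   at 0: the rectangle rule forces s ~ y + s or s ~ y - s when 0 ~ y. *)
Lemma even_chord_quad l :
  a l (- l) -> (2 < #|[set y | a 0%R y]|)%N -> closed_quad a.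
Proof.
move=> al card3; pose s := - l - l.
(* Two corners of this rectangle lie on the diagonal, where [a] vanishes, so the chord [a l (- l)]
   can be translated to start at any [i]. *)
have chord i : a i (i + s).
  have := rect 0 0 (i - l) l; rewrite !add0r !a_irr al subrK /s !addrA.
  by rewrite addn0; case: (a i _).
have [y [ay ys yNs]] : exists y, [/\ a 0 y, y != s & y != - s].
  case/card_gt2P: card3 => y1 [y2 [y3 [[]]]].
  rewrite !inE => a1 a2 a3 [n1 n2 n3].
  have [/andP[]|] := boolP ((y1 != s) && (y1 != - s)); first by exists y1.
  have [/andP[]|] := boolP ((y2 != s) && (y2 != - s)); first by exists y2.
  rewrite !negb_and !negbK => /orP[]/eqP e2 /orP[]/eqP e1; last 1 first.
  - by rewrite e1 e2 eqxx in n1.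
  - by rewrite e1 e2 eqxx in n1.
  - exists y3; split=> //; first by rewrite -e2 eq_sym.
    by rewrite -e1.
  - exists y3; split=> //; first by rewrite -e1.
    by rewrite -e2 eq_sym.
have := rect 0 y s s; rewrite !add0r ay addrK.
have a0s : a 0 s by rewrite -{1}[s]add0r.
have [asy _|_] := boolP (a s (y + s)).
  exists 0, s, (y + s), y; split; split=> //; [by rewrite a_sym..| |].
    by rewrite eq_sym addr_eq0.
  by rewrite eq_sym.
have [asy _|_] := boolP (a s (y - s)); last by case: (a _ _).
exists 0, s, (y - s), y; split; split=> //; [| by rewrite a_sym | |].
- by rewrite -{2}[y](subrK s).
- by rewrite eq_sym subr_eq0.
- by rewrite eq_sym.
Qed.

Hypothesis parity : forall y : R, exists h, y = h + h \/ y = 1 + h + h.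

(** Without an even chord, every neighbour of 0 has the form [1 + h + h]. The entries [a i j] of
    that class then depend on [i + j] alone (reflections, closing up after 6 steps) or on [i - j]
    alone (translations, closing up after 4). *)
Lemma rectangle_short_cycle :
  (2 < #|[set y | a 0%R y]|)%N -> closed_quad a \/ closed_hexa a.
Proof.
move=> card3; case: (pickP (fun l => a l (- l))) => [l al|no_even].
  by left; apply: even_chord_quad al card3.
have odd_nbr y : a 0 y -> exists h, y = 1 + h + h.
  have [h [->|->]] := parity y; last by exists h.
  have := no_even (- h); have := rect 0 0 h (- h).
  rewrite !add0r subrr opprK !a_irr => + nh; rewrite nh.
  by case: (a _ _).
case/card_gt2P: card3 => y1 [y2 [y3 [[]]]]; rewrite !inE.
move=> a1 a2 a3 [n12 n23 n31].
(* Characteristic coordinates on the odd class: the indices have sum [2m + 1] and difference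
   [2l - 1]. *)
pose f (m l : R) := a (m + l) (1 + m - l).
have fE m l : (f m l + f 0%R 0%R = f m 0%R + f 0%R l)%N.
  by have := rect 0 1 m l; rewrite /f !add0r !addr0 !subr0.
have nbrE y : a 0 y -> exists2 h, y = 1 + h + h & f h (- h).
  move=> ay; have [h yE] := odd_nbr y ay; exists h => //.
  by rewrite /f subrr opprK -yE.
case: (pickP (fun m => f m 0 != f 0 0)) => [m0 fm0|toeplitz].
  case: (pickP (fun l => f 0 l != f 0 0)) => [l0 fl0|hankel].
    (* If [f] varied in both coordinates, [f m0 l0] would have to be 2 or -1. *)
    move: (fE m0 l0) fm0 fl0.
    by case: (f m0 l0) (f m0 0) (f 0 l0) (f 0 0) => [] [] [] [].
  have refl y x : a 0 y -> a x (y - x).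
    case/nbrE=> h -> fh.
    have fmE m l : f m l = f m 0.
      move: (fE m l); have := hankel l => /negbFE/eqP->.
      by case: (f m l) (f m 0) (f 0 0) => [] [] [].
    have : f h (x - h) by rewrite fmE -(fmE h (- h)).
    by rewrite /f addrC subrK opprB addrA addrAC.
  (* Reflect 0 by [y1], [y2], [y3] in turn, twice: a product of three reflections is a reflection,
     hence an involution. Vertices two steps apart differ by some [yi - yj]. *)
  right; exists 0, y1, (y2 - y1), (y3 - (y2 - y1)), (y1 - (y3 - (y2 - y1))), y3.
  have -> : y1 - (y3 - (y2 - y1)) = y2 - y3 by ring.
  split.
  - by split=> //; apply: refl.
  - split; last by rewrite a_sym.
      by have := refl y1 (y3 - (y2 - y1)) a1; congr (a _ _); ring.
    by have := refl y2 (y2 - y3) a2; congr (a _ _); ring.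
  - split.
    + by rewrite eq_sym subr_eq0 eq_sym.
    + by rewrite -subr_eq0 (_ : _ - _ = y2 - y3) ?subr_eq0 //; ring.
    + by rewrite -subr_eq0 (_ : _ - _ = y3 - y1) ?subr_eq0 //; ring.
  - split; last by rewrite subr_eq0.
    by rewrite -subr_eq0 (_ : _ - _ = y1 - y2) ?subr_eq0 //; ring.
have trans y x : a 0 y -> a x (x + y).
  case/nbrE=> h -> fh.
  have flE m l : f m l = f 0 l.
    move: (fE m l); have := toeplitz m => /negbFE/eqP->.
    by case: (f m l) (f 0 l) (f 0 0) => [] [] [].
  have : f (x + h) (- h) by rewrite flE -(flE h (- h)).
  by rewrite /f addrK opprK; congr (a _ _); ring.
have quad y z : a 0 y -> a 0 z -> y != z -> y + z != 0 -> closed_quad a.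
  move=> ay az yz yz0; exists 0, y, (y + z), z; split.
    by split; rewrite ?trans // a_sym // addrC trans.
  by rewrite eq_sym.
(* The parallelogram on [y1], [y2] degenerates if [y2 = - y1]; then [y3] differs from [- y1] and
   replaces [y2]. *)
left; have [s12|] := eqVneq (y1 + y2) 0; last exact: quad.
apply: (quad y1 y3) => //; first by rewrite eq_sym.
by rewrite -s12 (inj_eq (addrI _)) eq_sym.
Qed.

End ShortCycles.

Lemma ord_parity (n : nat) (y : 'I_n.+3) :
  exists h, y = h + h \/ y = 1 + h + h.
Proof.
exists ((y : nat)./2%:R); rewrite -addrA -!natrD addnn.
have := odd_double_half y; case: (odd y) => yE; [right|left].
  by rewrite -[1]/(1%:R) -natrD yE natr_Zp.
by rewrite -[X in X%:R]add0n yE natr_Zp.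
Qed.

(** * Exclusion of short closed walks by the diagonal of [G_poly d D] at [A] *)

Section NoShortClosedWalks.

Variables (n d D : nat) (e : rel 'I_n.+1) (B : 'M[int]_n.+1).
Hypotheses (e_sym : symmetric e) (e_reg : regular_graph e d).
Hypotheses (d_gt0 : (0 < d)%N) (B_diag : forall x, B x x = 0).
Hypothesis defect : horner_mx (adj_mx e) (G_poly d D) = const_mx 1 + B.

(** The empty walk already accounts for the diagonal entry 1. Index [m] means length [m + 1], hence
    the strict bound. *)
Lemma nb_walks_closed m x y : (m < D)%N -> nb_walks _ e m x y x = 0%N.
Proof.
move=> mD; have := horner_G_poly_entry _ _ _ e_sym e_reg D x x d_gt0.
rewrite defect !mxE B_diag addr0 eqxx -[1]/(1%:R) => /eqP.
rewrite eqr_nat -{1}[1%N]addn0 eqn_add2l eq_sym sum_nat_eq0.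
move=> /forallP/(_ (Ordinal mD)) /=; rewrite /nb_walks_to sum_nat_eq0.
by move=> /forallP/(_ y)/eqP.
Qed.

Lemma no_closed_quad : (3 < D)%N -> ~ closed_quad e.
Proof.
move=> D3 [x [y [z [t [[xy yz zt tx] [xz yt]]]]]].
have := nb_walks_closed 3 x t D3; apply/eqP; rewrite -lt0n.
apply: (nb_walksS_gt0 _ _ _ _ z) => //; last by rewrite eq_sym.
apply: (nb_walksS_gt0 _ _ _ _ y) => //.
exact/(nb_walksS_gt0 _ _ _ _ x)/xz/yz/nb_walks0_gt0.
Qed.

Lemma no_closed_hexa : (5 < D)%N -> ~ closed_hexa e.
Proof.
move=> D5 [x0 [x1 [x2 [x3 [x4 [x5 []]]]]]].
move=> [a01 a12 a23] [a34 a45 a50] [n02 n13 n24] [n35 n40].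
have := nb_walks_closed 5 x0 x5 D5; apply/eqP; rewrite -lt0n.
apply: (nb_walksS_gt0 _ _ _ _ x4) => //.
apply: (nb_walksS_gt0 _ _ _ _ x3) => //.
apply: (nb_walksS_gt0 _ _ _ _ x2) => //.
apply: (nb_walksS_gt0 _ _ _ _ x1) => //.
exact/(nb_walksS_gt0 _ _ _ _ x0)/n02/a12/nb_walks0_gt0.
Qed.

End NoShortClosedWalks.

(** * Commutation with the cycle matrix and the bound on the diameter *)

Lemma adj_mx_comm_const (n d : nat) (e : rel 'I_n.+1) :
  symmetric e -> regular_graph e d ->
  adj_mx e *m const_mx 1 = const_mx 1 *m adj_mx e.
Proof.
move=> e_sym e_reg.
have AJ : adj_mx e *m const_mx 1 = const_mx d%:R :> 'M_n.+1.
  apply/matrixP => x y; rewrite !mxE -(sum_edges _ _ _ e_reg x) natr_sum.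
  by apply: eq_bigr => z _; rewrite !mxE mulr1.
have symA : (adj_mx e)^T = adj_mx e.
  by apply/matrixP => x y; rewrite !mxE e_sym.
by rewrite AJ -[RHS]trmxK trmx_mul symA trmx_const AJ trmx_const.
Qed.

Lemma cyclic_defect_diameter (n d D : nat) (e : rel 'I_n.+1) :
  cyclic_defect_graph e d D -> (D < 6)%N.
Proof.
case=> -[e_sym e_irr] [e_reg d3] _ [B [n3 [v cycB]] defect].
rewrite ltnNge; apply/negP => D6.
case: n n3 => [|[|n]] // _ in e e_sym e_irr e_reg B v cycB defect *.
have d_gt0 : (0 < d)%N by apply: leq_trans d3.
have B_diag x : B x x = 0.
  rewrite -[x](permKV v) cycB orbb; case: eqP => // /(congr1 val) /=.
  have := ltn_ord ((v^-1)%g x); rewrite leq_eqVlt => /orP[/eqP i_max|i_lt].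
    by rewrite i_max modnn => i0; rewrite i0 in i_max.
  by rewrite modn_small //; lia.
have comm : adj_mx e *m B = B *m adj_mx e.
  have -> : B = horner_mx (adj_mx e) (G_poly d D) - const_mx 1.
    by rewrite defect addrAC subrr add0r.
  rewrite mulmxBr mulmxBl (adj_mx_comm_const _ _ _ e_sym e_reg); congr (_ - _).
  exact: comm_mx_horner.
pose a : rel 'I_n.+3 := fun i j => e (v i) (v j).
have wave (i j : 'I_n.+3) : (a i (j - 1))%:R + (a i (j + 1))%:R =
    (a (i - 1) j)%:R + (a (i + 1) j)%:R :> int.
  have := congr1 (fun M : 'M__ => M (v i) (v j)) comm.
  by rewrite (mulmx_cycler _ _ _ _ cycB) (mulmx_cyclel _ _ _ _ cycB) !mxE.
(* Every residue is a natural multiple of 1, so [wave_rectangle] covers all shifts [m], [l]. *)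
have rect (i j m l : 'I_n.+3) :
   (a (i + m + l)%R (j + m - l)%R + a i j =
    a (i + m)%R (j + m)%R + a (i + l)%R (j - l)%R)%N.
  have cross (p q r s : nat) :
      p%:R - q%:R = r%:R - s%:R :> int -> (p + s = q + r)%N by lia.
  apply: cross; have := wave_rectangle _ (fun i j => (a i j)%:R) wave i j m l.
  by rewrite !natr_Zp.
have a_sym : symmetric a by move=> i j; apply: e_sym.
have a_irr : irreflexive a by move=> i; apply: e_irr.
have deg0 : (2 < #|[set y | a 0%R y]|)%N.
  rewrite (_ : [set y | a 0 y] = v @^-1: [set y | e (v 0) y]).
    by rewrite card_preimset ?e_reg //; apply: perm_inj.
  by apply/setP => y; rewrite !inE.
have [] := rectangle_short_cycle _ a a_sym a_irr rect (ord_parity n) deg0.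
- case=> x [y [z [t [edges neqs]]]].
  apply: (no_closed_quad _ _ _ _ _ e_sym e_reg d_gt0 B_diag defect).
    exact: leq_trans D6.
  by exists (v x), (v y), (v z), (v t); rewrite !(inj_eq perm_inj).
case=> x0 [x1 [x2 [x3 [x4 [x5 [e1 e2 n1 n2]]]]]].
apply: (no_closed_hexa _ _ _ _ _ e_sym e_reg d_gt0 B_diag defect) => //.
by exists (v x0), (v x1), (v x2), (v x3), (v x4), (v x5);
   rewrite !(inj_eq perm_inj).
Qed.

Local Close Scope ring_scope.

Theorem theorem3 (n d D : nat) (e : rel 'I_n.+1) :
  odd d -> 3 <= d -> D = 0 %[mod 6] -> ~ cyclic_defect_graph e d D.
Proof.
move=> _ _ D0 cyc; have D6 := cyclic_defect_diameter _ _ _ _ cyc.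
(* A multiple of 6 below 6 is 0, against [2 <= D]. *)
by case: cyc => _ _ [_ D2] _; rewrite !modn_small // in D0; rewrite D0 in D2.
Qed.
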